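(* Let $\mathbb{F}$ be a field and let $M$ be a finitely presented $2$-parameter persistence module over $\mathbb{F}$, indexed by $\mathbb{N}^2$ and extended by zero to $\mathbb{Z}^2$. For each $\alpha\in\mathbb{Z}^2$, let $z_\alpha^M$ denote the multiplicity of $\mathbb{F}[\alpha,\alpha]$ in the barcode of the $\alpha$-outward frame of $M$, and let $y_\alpha^M$ denote the multiplicity of $\mathbb{F}[\alpha,\alpha]$ in the barcode of the into-$\alpha$ frame of $M$. Then for all $\alpha\in\mathbb{N}^2$, the bigraded Betti numbers of $M$ satisfy $$\beta_0^M(\alpha)=y_\alpha^M,$$ $$\beta_1^M(\alpha)=y_\alpha^M-\dim(M_\alpha)+\dim(M_{\alpha-e_1})+\dim(M_{\alpha-e_2})-\dim(M_{\alpha-e_1-e_2})+z^M_{\alpha-e_1-e_2},$$ $$\beta_2^M(\alpha)=z^M_{\alpha-e_1-e_2}.$$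
   Context: Here $\mathbb{N}=\{0,1,2,\dots\}$, $e_1=(1,0)$, $e_2=(0,1)$, and $\alpha\le\beta$ means coordinatewise inequality. **Persistence modules.** A $2$-parameter persistence module $M$ over $\mathbb{F}$ assigns an $\mathbb{F}$-vector space $M_\alpha$ to each $\alpha\in\mathbb{N}^2$ and a linear map ${}^M\phi_\alpha^{\alpha+e_i}:M_\alpha\to M_{\alpha+e_i}$ to each $\alpha\in\mathbb{N}^2$, $i=1,2$, so that the resulting diagram commutes. For $\alpha\le\beta$, ${}^M\phi_\alpha^\beta:M_\alpha\to M_\beta$ is the resulting well-defined composite (the identity if $\alpha=\beta$). A homomorphism $\mu:M\to N$ is a collection of linear maps $\mu_\alpha:M_\alpha\to N_\alpha$ with ${}^N\phi_\alpha^\beta\circ\mu_\alpha=\mu_\beta\circ{}^M\phi_\alpha^\beta$ for all $\alpha\le\beta$. Kernels and direct sums are formed vertexwise. Such modules correspond to $\mathbb{N}^2$-graded modules over $\mathbb{F}[x_1,x_2]$, via $\bigoplus_\alpha M_\alpha$ with $x_i\cdot v={}^M\phi_\alpha^{\alpha+e_i}(v)$ for $v\in M_\alpha$. Finitely generated, finitely presented and free are understood through this correspondence. In particular all $M_\alpha$ are finite dimensional. The module is extended to $\mathbb{Z}^2$ by setting $M_\beta=0$ for $\beta\in\mathbb{Z}^2\setminus\mathbb{N}^2$, with zero maps out of such vertices. **Frames and barcodes.** The into-$\alpha$ frame of $M$ is the restriction of $M$ to $\alpha-e_1\to\alpha\leftarrow\alpha-e_2$, i.e. the diagram $M_{\alpha-e_1}\to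 M_\alpha\leftarrow M_{\alpha-e_2}$. The $\alpha$-outward frame is the restriction of $M$ to $\alpha+e_1\leftarrow\alpha\to\alpha+e_2$, i.e. the diagram $M_{\alpha+e_1}\leftarrow M_\alpha\to M_{\alpha+e_2}$. Each is a zigzag persistence module on a path with three vertices. It decomposes uniquely, up to order and isomorphism, as a finite direct sum of interval modules, which have $\mathbb{F}$ at each vertex of a nonempty subinterval of the path, identity maps within that subinterval, and zero elsewhere. The multiset of intervals is its barcode. $\mathbb{F}[\alpha,\alpha]$ denotes the interval module with $\mathbb{F}$ at the vertex $\alpha$ and zero at the other vertices. **Bigraded Betti numbers.** For a finitely generated module $M$ put $W_\alpha^M=M_\alpha/\sum_i \operatorname{im}({}^M\phi_{\alpha-e_i}^\alpha)$ and $\beta_0^M(\alpha)=\dim W_\alpha^M$. Let $\mathbb{F}_2(\alpha)$ be the module with $(\mathbb{F}_2(\alpha))_\beta=\mathbb{F}$ if $\alpha\le\beta$ and $0$ otherwise, with identity maps between nonzero spaces. Let $F_0(M)=\bigoplus_{\alpha}\mathbb{F}_2(\alpha)^{\beta_0^M(\alpha)}$. Choosing for each $\alpha$ elements $w_\alpha^1,\dots,w_\alpha^{\beta_0^M(\alpha)}\in M_\alpha$ whose classes form a basis of $W^M_\alpha$, there is a surjective homomorphism $\gamma:F_0(M)\to M$ sending the generator of the $k$-th copy of $\mathbb{F}_2(\alpha)$ to $w_\alpha^k$. Let $K_0(M)=\ker\gamma$. It is independent of choices up to isomorphism. Inductively, for $j\ge1$, $F_j(M)=F_0(K_{j-1}(M))$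 and $K_j(M)=K_0(K_{j-1}(M))$, the kernel of the surjection $F_j(M)\to K_{j-1}(M)$ constructed in the same way. For $j\ge1$ the $j$-th bigraded Betti number is the function $\beta_j^M=\beta_0^{K_{j-1}(M)}:\mathbb{N}^2\to\mathbb{N}$. *)

(* Defs.v *)
From HB Require Import structures.
From mathcomp Require Import all_boot all_order all_algebra.
From mathcomp Require Import boolp classical_sets.

Set Implicit Arguments.
Unset Strict Implicit.
Unset Printing Implicit Defensive.

Import Order.TTheory GRing.Theory Num.Theory.
Local Open Scope ring_scope.

(* Vertex spaces are finite dimensional (vectType): finitely presented modules
   have this property, and it is inherited by their free covers and syzygies. *)
Record pmod (F : fieldType) := Pmod {
  pm_sp :> nat -> nat -> vectType F;
  pm_x : forall i j, 'Hom(pm_sp i j, pm_sp i.+1 j);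
  pm_y : forall i j, 'Hom(pm_sp i j, pm_sp i j.+1);
  pm_comm : forall i j,
    (pm_x i j.+1 \o pm_y i j = pm_y i.+1 j \o pm_x i j)%VF
}.

(* The composite V i -> V i.+1 -> ... -> V i' for i <= i'; the value is 0 when
   i' < i. *)
Fixpoint steps (F : fieldType) (V : nat -> vectType F)
    (s : forall k, 'Hom(V k, V k.+1)) (i i' : nat) {struct i'} :
    'Hom(V i, V i') :=
  match i', i return 'Hom(V i, V i') with
  | 0%N, 0%N => \1%VF
  | k.+1, 0%N => (s k \o steps s 0 k)%VF
  | k.+1, l.+1 => steps (V := fun n => V n.+1) (fun n => s n.+1) l k
  | 0%N, l.+1 => 0
  end.

(* The transition map from the vertex (i, j) to the vertex (i', j'), meaningful
   when i <= i' and j <= j', and 0 otherwise. *)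
Definition phi (F : fieldType) (M : pmod F) (i j i' j' : nat) :
    'Hom(M i j, M i' j') :=
  (steps (V := fun k => M k j') (fun k => pm_x M k j') i i'
     \o steps (pm_y M i) j j')%VF.

Definition ext (F : fieldType) (M : pmod F) (a : int * int) : vectType F :=
  match a with
  | (Posz i, Posz j) => M i j
  | _ => 'rV[F]_0
  end.

Definition ext_phi (F : fieldType) (M : pmod F) (a b : int * int) :
    'Hom(ext M a, ext M b) :=
  match a, b return 'Hom(ext M a, ext M b) with
  | (Posz i, Posz j), (Posz k, Posz l) => phi M i j k l
  | _, _ => 0
  end.

Definition vtx (i j : nat) : int * int := (Posz i, Posz j).
Definition e1 : int * int := (1, 0).
Definition e2 : int * int := (0, 1).

Record pm_hom (F : fieldType) (M N : pmod F) := PmHom {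
  hom_map :> forall i j, 'Hom(M i j, N i j);
  hom_nat : forall i j i' j', (i <= i')%N -> (j <= j')%N ->
    (phi N i j i' j' \o hom_map i j = hom_map i' j' \o phi M i j i' j')%VF
}.

Section StepFacts.
Variable F : fieldType.

Lemma steps_refl (V : nat -> vectType F) (s : forall k, 'Hom(V k, V k.+1)) i :
  steps s i i = \1%VF.
Proof. by elim: i V s => [|i IHi] V s //=; rewrite IHi. Qed.

Lemma stepsS (V : nat -> vectType F) (s : forall k, 'Hom(V k, V k.+1)) i k :
  (i <= k)%N -> steps s i k.+1 = (s k \o steps s i k)%VF.
Proof.
elim: k i V s => [|k IHk] [|i] V s // le_ik.
exact: (IHk i (fun n => V n.+1) (fun n => s n.+1)).
Qed.

Lemma steps_nat (V W : nat -> vectType F) (s : forall k, 'Hom(V k, V k.+1))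
    (t : forall k, 'Hom(W k, W k.+1)) (h : forall k, 'Hom(V k, W k)) :
  (forall k, (t k \o h k = h k.+1 \o s k)%VF) ->
  forall i i', (i <= i')%N -> (steps t i i' \o h i = h i' \o steps s i i')%VF.
Proof.
move=> hn i i'; elim: i' => [|k IHk].
  by rewrite leqn0 => /eqP ->; rewrite !steps_refl comp_lfun1l comp_lfun1r.
rewrite leq_eqVlt => /orP[/eqP -> | lt_ik].
  by rewrite !steps_refl comp_lfun1l comp_lfun1r.
by rewrite !stepsS // -comp_lfunA IHk // comp_lfunA hn comp_lfunA.
Qed.

Lemma phiSx (M : pmod F) i j i' j' : (i <= i')%N -> (j <= j')%N ->
  phi M i j i'.+1 j' = (pm_x M i' j' \o phi M i j i' j')%VF.
Proof. by move=> le_i le_j; rewrite /phi comp_lfunA stepsS. Qed.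

Lemma phiSy (M : pmod F) i j i' j' : (i <= i')%N -> (j <= j')%N ->
  phi M i j i' j'.+1 = (pm_y M i' j' \o phi M i j i' j')%VF.
Proof.
move=> le_i le_j; rewrite /phi (stepsS (pm_y M i)) // !comp_lfunA.
congr (_ \o _)%VF.
rewrite (steps_nat (V := fun k => M k j') (W := fun k => M k j'.+1)
  (s := fun k => pm_x M k j') (h := fun k => pm_y M k j')) // => k.
exact: pm_comm.
Qed.

Lemma hom_of_steps (M N : pmod F) (h : forall i j, 'Hom(M i j, N i j)) :
  (forall i j, (pm_x N i j \o h i j = h i.+1 j \o pm_x M i j)%VF) ->
  (forall i j, (pm_y N i j \o h i j = h i j.+1 \o pm_y M i j)%VF) ->
  forall i j i' j', (i <= i')%N -> (j <= j')%N ->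
    (phi N i j i' j' \o h i j = h i' j' \o phi M i j i' j')%VF.
Proof.
move=> hx hy i j i' j' le_i le_j; rewrite /phi -comp_lfunA.
rewrite (steps_nat (s := pm_y M i) (t := pm_y N i) (h := h i)) //.
rewrite !comp_lfunA; congr (_ \o _)%VF.
by rewrite (steps_nat (V := fun k => M k j') (W := fun k => N k j')
  (s := fun k => pm_x M k j') (t := fun k => pm_x N k j')
  (h := fun k => h k j')).
Qed.

Lemma hom_x (M N : pmod F) (f : pm_hom M N) i j :
  (pm_x N i j \o f i j = f i.+1 j \o pm_x M i j)%VF.
Proof.
have := hom_nat f (leqnSn i) (leqnn j).
by rewrite !phiSx // /phi !steps_refl !comp_lfun1r.
Qed.

Lemma hom_y (M N : pmod F) (f : pm_hom M N) i j :
  (pm_y N i j \o f i j = f i j.+1 \o pm_y M i j)%VF.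
Proof.
have := hom_nat f (leqnn i) (leqnSn j).
by rewrite !phiSy // /phi !steps_refl !comp_lfun1r.
Qed.

End StepFacts.

Section Kernel.
Variables (F : fieldType) (M N : pmod F) (f : pm_hom M N).

Definition ker_x i j :
    'Hom(subvs_of (lker (f i j)), subvs_of (lker (f i.+1 j))) :=
  linfun (fun v => vsproj (lker (f i.+1 j)) (pm_x M i j (vsval v))).

Definition ker_y i j :
    'Hom(subvs_of (lker (f i j)), subvs_of (lker (f i j.+1))) :=
  linfun (fun v => vsproj (lker (f i j.+1)) (pm_y M i j (vsval v))).

Lemma ker_xE i j v : vsval (ker_x i j v) = pm_x M i j (vsval v).
Proof.
rewrite /ker_x.
rewrite (lfunE (vsproj (lker (f i.+1 j)) \o (pm_x M i j \o vsval))) /=.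
rewrite vsprojK // memv_ker.
have /lfunP/(_ (vsval v)) := hom_x f i j; rewrite !comp_lfunE /= => <-.
by have:= subvsP v; rewrite memv_ker => /eqP ->; rewrite linear0.
Qed.

Lemma ker_yE i j v : vsval (ker_y i j v) = pm_y M i j (vsval v).
Proof.
rewrite /ker_y.
rewrite (lfunE (vsproj (lker (f i j.+1)) \o (pm_y M i j \o vsval))) /=.
rewrite vsprojK // memv_ker.
have /lfunP/(_ (vsval v)) := hom_y f i j; rewrite !comp_lfunE /= => <-.
by have:= subvsP v; rewrite memv_ker => /eqP ->; rewrite linear0.
Qed.

Lemma ker_comm i j :
  (ker_x i j.+1 \o ker_y i j = ker_y i.+1 j \o ker_x i j)%VF.
Proof.
apply/lfunP => v; apply: val_inj; rewrite !comp_lfunE /=.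
rewrite ker_xE ker_yE ker_yE ker_xE.
by have /lfunP/(_ (vsval v)) := pm_comm M i j; rewrite !comp_lfunE.
Qed.

Definition kernel : pmod F := Pmod ker_comm.

End Kernel.

(* free F d is the direct sum, over all vertices a, of d a copies of the module
   having F at every vertex b >= a, with identity maps, and 0 elsewhere.
   Its space at (i, j) has as a basis the generators of degree at most (i, j),
   and its transition maps send each basis vector to the same generator. *)
Definition gens (d : nat -> nat -> nat) (i j : nat) : finType :=
  {a : 'I_i.+1 * 'I_j.+1 & 'I_(d a.1 a.2)}.

Definition incl_x d i j (g : gens d i j) : gens d i.+1 j :=
  @existT _ (fun a : 'I_i.+2 * 'I_j.+1 => 'I_(d a.1 a.2))
    (widen_ord (leqnSn i.+1) (tag g).1, (tag g).2) (tagged g).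

Definition incl_y d i j (g : gens d i j) : gens d i j.+1 :=
  @existT _ (fun a : 'I_i.+1 * 'I_j.+2 => 'I_(d a.1 a.2))
    ((tag g).1, widen_ord (leqnSn j.+1) (tag g).2) (tagged g).

Definition push (F : fieldType) (I J : finType) (u : I -> J)
    (x : {ffun I -> F^o}) : {ffun J -> F^o} :=
  [ffun b => \sum_(a | u a == b) x a].

Section Free.
Variable F : fieldType.

Lemma push_linear (I J : finType) (u : I -> J) : linear (push (F := F) u).
Proof.
move=> c x y; apply/ffunP => b; rewrite !ffunE scaler_sumr -big_split.
by apply: eq_bigr => a _; rewrite !ffunE.
Qed.
HB.instance Definition _ (I J : finType) (u : I -> J) :=
  GRing.isLinear.Build F {ffun I -> F^o} {ffun J -> F^o} _
    (push (F := F) u) (push_linear u).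

Lemma push_comp (I J K : finType) (u : I -> J) (v : J -> K)
    (x : {ffun I -> F^o}) :
  push v (push u x) = push (v \o u) x.
Proof.
apply/ffunP => c; rewrite !ffunE.
rewrite (partition_big u (fun b => v b == c)) //=.
apply: eq_bigr => b /eqP vb; rewrite ffunE.
by apply: eq_bigl => a; case: eqP => [->|]; rewrite ?vb ?eqxx ?andbF.
Qed.

Variable d : nat -> nat -> nat.

Lemma incl_comm i j (g : gens d i j) : incl_x (incl_y g) = incl_y (incl_x g).
Proof. by case: g => -[a b] k. Qed.

Lemma free_comm i j :
  (linfun (push (F := F) (@incl_x d i j.+1)) \o linfun (push (@incl_y d i j))
   = linfun (push (@incl_y d i.+1 j)) \o linfun (push (@incl_x d i j)))%VF.
Proof.
apply/lfunP => x; rewrite !comp_lfunE !lfunE /= !push_comp.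
by apply/ffunP => c; rewrite !ffunE; apply: eq_bigl => a /=; rewrite incl_comm.
Qed.

Definition free : pmod F :=
  @Pmod F (fun i j => {ffun gens d i j -> F^o})
    (fun i j => linfun (push (@incl_x d i j)))
    (fun i j => linfun (push (@incl_y d i j))) free_comm.

End Free.

Definition fin_supp (d : nat -> nat -> nat) : Prop :=
  exists n, forall i j, d i j != 0%N -> (i < n)%N /\ (j < n)%N.

(* Graded modules: exact sequence free d1 -> free d0 -> M -> 0 with free modules
   of finite rank. *)
Definition finitely_presented (F : fieldType) (M : pmod F) : Prop :=
  exists d0 d1, [/\ fin_supp d0, fin_supp d1 &
    exists (p : pm_hom (free F d1) (free F d0)) (q : pm_hom (free F d0) M),
      forall i j, limg (q i j) = fullv /\ limg (p i j) = lker (q i j)].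

(* The quotient space V / U, realized on a complement of U. *)
Definition quotv (F : fieldType) (V : vectType F) (U : {vspace V}) :
    vectType F :=
  subvs_of (U^C)%VS.

Definition quot_pi (F : fieldType) (V : vectType F) (U : {vspace V}) :
    'Hom(V, quotv U) :=
  linfun (vsproj (U^C)%VS \o daddv_pi (U^C)%VS U).

Lemma lker_quot_pi (F : fieldType) (V : vectType F) (U : {vspace V}) :
  lker (quot_pi U) = U.
Proof.
have dx : (U^C :&: U = 0)%VS by rewrite capvC capv_compl.
apply/vspaceP => v; rewrite memv_ker /quot_pi.
rewrite (lfunE (vsproj _ \o daddv_pi _ _)) /=.
have vE : daddv_pi (U^C)%VS U v + daddv_pi U (U^C)%VS v = v.
  by apply: daddv_pi_add; rewrite // addvC addv_complf memvf.
rewrite -(inj_eq val_inj) /= vsprojK ?memv_pi //.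
apply/eqP/idP => [v0 | Uv].
  by rewrite -vE v0 add0r memv_pi.
apply/eqP; rewrite -memv0 -dx memv_cap memv_pi /=.
move/(canRL (addrK _)): vE => ->.
by rewrite memvB // memv_pi.
Qed.

Lemma limg_quot_pi (F : fieldType) (V : vectType F) (U : {vspace V}) :
  limg (quot_pi U) = fullv.
Proof.
have dx : (U^C :&: U = 0)%VS by rewrite capvC capv_compl.
apply/vspaceP => w; rewrite memvf; apply/memv_imgP.
exists (vsval w); rewrite ?memvf // /quot_pi.
rewrite (lfunE (vsproj _ \o daddv_pi _ _)) /=.
by rewrite daddv_pi_id ?subvsP // vsvalK.
Qed.

Definition img_into (F : fieldType) (M : pmod F) (i j : nat) :
    {vspace M i j} :=
  (limg (ext_phi M (vtx i j - e1) (vtx i j)) +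
   limg (ext_phi M (vtx i j - e2) (vtx i j)))%VS.

Definition Wsp (F : fieldType) (M : pmod F) (i j : nat) : vectType F :=
  quotv (img_into M i j).

Definition beta0 (F : fieldType) (M : pmod F) (i j : nat) : nat :=
  \dim {: Wsp M i j}.

Record min_gens (F : fieldType) (M : pmod F) := MinGens {
  mg :> forall i j, (beta0 M i j).-tuple (M i j);
  mg_basis : forall i j,
    basis_of {: Wsp M i j} [seq quot_pi (img_into M i j) v | v <- mg i j]
}.

Lemma min_gens_exist (F : fieldType) (M : pmod F) : inhabited (min_gens M).
Proof.
pose w i j := map_tuple (fun v => (quot_pi (img_into M i j))^-1%VF v)
  (vbasis {: Wsp M i j}).
suff wP i j :
    basis_of {: Wsp M i j} [seq quot_pi (img_into M i j) v | v <- w i j].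
  exact: (inhabits (MinGens wP)).
rewrite /w /= -map_comp (_ : map _ _ = vbasis {: Wsp M i j}) ?vbasisP //.
rewrite -[RHS]map_id; apply: eq_map => v /=.
by apply: limg_lfunVK; rewrite limg_quot_pi memvf.
Qed.

Lemma min_gens_select (F : fieldType) :
  inhabited (forall M : pmod F, min_gens M).
Proof.
have wP (M : pmod F) : exists _ : min_gens M, True.
  by case: (min_gens_exist M) => w; exists w.
exact: inhabits (fun M => projT1 (cid (wP M))).
Qed.

Section FreeCover.
Variables (F : fieldType) (M : pmod F) (w : min_gens M).

Definition F0 : pmod F := free F (beta0 M).

Definition gen_img i j (g : gens (beta0 M) i j) : M i j :=
  phi M (tag g).1 (tag g).2 i j (tnth (w (tag g).1 (tag g).2) (tagged g)).

Definition gamma_fun i j (x : F0 i j) : M i j :=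
  \sum_(g : gens (beta0 M) i j) x g *: gen_img g.

Lemma gamma_linear i j : linear (@gamma_fun i j).
Proof.
move=> c x y; rewrite /gamma_fun scaler_sumr -big_split.
by apply: eq_bigr => g _; rewrite !ffunE scalerDl scalerA.
Qed.
HB.instance Definition _ i j :=
  GRing.isLinear.Build F (F0 i j) (M i j) _ (@gamma_fun i j) (@gamma_linear i j).

Definition gamma_map i j : 'Hom(F0 i j, M i j) := linfun (@gamma_fun i j).

Lemma gamma_push i j i' j' (u : gens (beta0 M) i j -> gens (beta0 M) i' j')
    (f : 'Hom(M i j, M i' j')) (x : F0 i j) :
  (forall g, gen_img (u g) = f (gen_img g)) ->
  f (gamma_fun x) = gamma_fun (push u x).
Proof.
move=> uf; rewrite /gamma_fun linear_sum (partition_big u predT) //=.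
apply: eq_bigr => g' _; rewrite ffunE scaler_suml.
by apply: eq_bigr => g /eqP <-; rewrite uf linearZ.
Qed.

Lemma gamma_x i j :
  (pm_x M i j \o gamma_map i j = gamma_map i.+1 j \o pm_x F0 i j)%VF.
Proof.
apply/lfunP => x; rewrite !comp_lfunE !lfunE /=.
apply: gamma_push => -[[a b] k]; rewrite /gen_img /=.
by rewrite phiSx ?comp_lfunE // -ltnS ltn_ord.
Qed.

Lemma gamma_y i j :
  (pm_y M i j \o gamma_map i j = gamma_map i j.+1 \o pm_y F0 i j)%VF.
Proof.
apply/lfunP => x; rewrite !comp_lfunE !lfunE /=.
apply: gamma_push => -[[a b] k]; rewrite /gen_img /=.
by rewrite phiSy ?comp_lfunE // -ltnS ltn_ord.
Qed.

Definition gamma : pm_hom F0 M := PmHom (hom_of_steps gamma_x gamma_y).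

Definition K0 : pmod F := kernel gamma.

End FreeCover.

(* w selects the lifted bases at every stage of the resolution; statements are
   meant to be quantified over all such selections. *)
Definition betti (F : fieldType) (w : forall M : pmod F, min_gens M)
    (k : nat) (M : pmod F) (i j : nat) : nat :=
  beta0 (iter k (fun N => K0 (w N)) M) i j.

(* Representations on three vertices with arrows E. *)
Record diag3 (F : fieldType) (E : rel 'I_3) := Diag3 {
  dg_sp :> 'I_3 -> vectType F;
  dg_map : forall u v, E u v -> 'Hom(dg_sp u, dg_sp v)
}.

Definition iso3 (F : fieldType) (E : rel 'I_3) (Z Z' : diag3 F E) : Prop :=
  exists h : forall v, 'Hom(Z v, Z' v),
    (forall v, bijective (h v)) /\
    (forall u v (e : E u v),
       (h v \o dg_map Z e = dg_map Z' e \o h u)%VF).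

Definition zero3 (F : fieldType) (E : rel 'I_3) : diag3 F E :=
  @Diag3 F E (fun _ => 'rV[F]_0) (fun _ _ _ => 0).

Section PairMap.
Variables (F : fieldType) (U1 U2 V1 V2 : vectType F).
Variables (f : 'Hom(U1, V1)) (g : 'Hom(U2, V2)).

Definition pair_fun (x : U1 * U2) : V1 * V2 := (f x.1, g x.2).

Lemma pair_fun_linear : linear pair_fun.
Proof. by move=> c x y; rewrite /pair_fun /= !linearP. Qed.
HB.instance Definition _ :=
  GRing.isLinear.Build F (U1 * U2)%type (V1 * V2)%type _
    pair_fun pair_fun_linear.

Definition pair_map : 'Hom((U1 * U2)%type, (V1 * V2)%type) := linfun pair_fun.

End PairMap.

Definition sum3 (F : fieldType) (E : rel 'I_3) (Z Z' : diag3 F E) :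
    diag3 F E :=
  @Diag3 F E (fun v => (Z v * Z' v)%type)
    (fun u v e => pair_map (dg_map Z e) (dg_map Z' e)).

(* Nonempty subintervals of the path 0 - 1 - 2, given by their endpoints. *)
Definition itv3 : Type := {bd : 'I_3 * 'I_3 | (bd.1 <= bd.2)%N}.
HB.instance Definition _ := Choice.on itv3.

Definition in_itv3 (I : itv3) (v : 'I_3) : bool :=
  ((val I).1 <= v <= (val I).2)%N.

Definition ind_sp (F : fieldType) (b : bool) : vectType F :=
  if b then (F^o : vectType F) else ('rV[F]_0 : vectType F).

Definition ind_map (F : fieldType) (b c : bool) :
    'Hom(ind_sp F b, ind_sp F c) :=
  match b, c return 'Hom(ind_sp F b, ind_sp F c) with
  | true, true => \1%VF
  | _, _ => 0
  end.

Definition itv_mod (F : fieldType) (E : rel 'I_3) (I : itv3) : diag3 F E :=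
  @Diag3 F E (fun v => ind_sp F (in_itv3 I v))
    (fun u v _ => ind_map F (in_itv3 I u) (in_itv3 I v)).

Definition itv_sum (F : fieldType) (E : rel 'I_3) (s : seq itv3) : diag3 F E :=
  foldr (fun I Z => sum3 (itv_mod F E I) Z) (zero3 F E) s.

(* The barcode, as a list determined up to permutation; classical choice picks
   one of the decompositions into interval modules. *)
Definition barcode (F : fieldType) (E : rel 'I_3) (Z : diag3 F E) :
    seq itv3 :=
  xget [::] [set s | iso3 Z (itv_sum F E s)]%classic.

Definition multiplicity (F : fieldType) (E : rel 'I_3) (I : itv3)
    (Z : diag3 F E) : nat :=
  count_mem I (barcode Z).

Definition restr (F : fieldType) (M : pmod F) (p : 'I_3 -> int * int)
    (E : rel 'I_3) : diag3 F E :=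
  @Diag3 F E (fun v => ext M (p v)) (fun u v _ => ext_phi M (p u) (p v)).

Definition mid : 'I_3 := @Ordinal 3 1 isT.

Definition into_arrows : rel 'I_3 := fun u v => (u != mid) && (v == mid).
Definition out_arrows : rel 'I_3 := fun u v => (u == mid) && (v != mid).

Definition into_frame (F : fieldType) (M : pmod F) (a : int * int) :
    diag3 F into_arrows :=
  restr M (fun v => nth a [:: a - e1; a; a - e2] v) into_arrows.

Definition out_frame (F : fieldType) (M : pmod F) (a : int * int) :
    diag3 F out_arrows :=
  restr M (fun v => nth a [:: a + e1; a; a + e2] v) out_arrows.

Definition mid_itv : itv3 := exist _ (mid, mid) (leqnn mid).

Definition y_mult (F : fieldType) (M : pmod F) (a : int * int) : nat :=
  multiplicity mid_itv (into_frame M a).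

Definition z_mult (F : fieldType) (M : pmod F) (a : int * int) : nat :=
  multiplicity mid_itv (out_frame M a).

Definition dimv (F : fieldType) (M : pmod F) (a : int * int) : nat :=
  \dim {: ext M a}.

(* Main.v *)
From HB Require Import structures.
From mathcomp Require Import all_boot all_order all_algebra.
From mathcomp Require Import zify.
From mathcomp Require classical_sets.
Require Import Defs.

(** Write chi_N(a) = dim N_a - dim N_(a-e1) - dim N_(a-e2) + dim N_(a-e1-e2).

    The barcode side is linear algebra. The number of copies of the simple
    module at the middle vertex is additive over direct sums and an isomorphism
    invariant; evaluating on the six interval modules identifies it with
    the codimension of the sum of the two images for an inward frame
    ([into_multiplicity]) and with the dimension of the intersection of the two
    kernels for an outward frame ([out_multiplicity]). Since the barcode is
    chosen among the decompositions of a frame, one also has to know that a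
    decomposition exists: choose a basis of the middle space adapted to the two
    images (or kernels) and transport it along the arrows
    ([into_decomposition], [out_decomposition]). The formula for beta_0 is then
    the definition of W_a.

    The other two formulas come from the square a-e1-e2, a-e1, a-e2, a. Let K
    be the kernel of the free cover F_0 -> N. In F_0, hence in K, multiplication
    by x_1 and by x_2 is injective, so beta_0^K(a) - chi_K(a) is the difference
    dim (x_1 K cap x_2 K)_a - dim K_(a-e1-e2). An element of x_1 F_0 cap x_2 F_0
    is x_1 x_2 t for a unique t; it lies in x_1 K cap x_2 K exactly when x_1 and
    x_2 both kill the image of t in N. This gives the key identity
    ([beta0_syzygy])
      beta_0^K(a) = chi_K(a) + z^N_(a-e1-e2).
    Furthermore chi_K = chi_(F_0) - chi_N as the cover is surjective
    ([syzygy_dim]), chi_(F_0) = beta_0^N by counting generators ([free_euler]),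
    and z^K = 0 ([z_mult_syzygy]).

    With N = M the key identity is the formula for beta_1. With N = K_0(M) it
    becomes beta_2^M(a) = beta_1^M(a) - chi_(K_0(M))(a), and the right-hand side
    is z^M_(a-e1-e2) by the key identity for M. *)

Set Implicit Arguments.
Unset Strict Implicit.
Unset Printing Implicit Defensive.

Import Order.TTheory GRing.Theory Num.Theory.
Local Open Scope ring_scope.

(** * Subspaces of a direct sum of two spaces *)

Section ProductSubspace.
Variables (F : fieldType) (U1 U2 : vectType F).

Definition prodv (A : {vspace U1}) (B : {vspace U2}) :
    {vspace (U1 * U2)%type} :=
  limg (pair_map (linfun (vsval : subvs_of A -> U1))
                 (linfun (vsval : subvs_of B -> U2))).

Lemma memv_prod A B x : (x \in prodv A B) = (x.1 \in A) && (x.2 \in B).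
Proof.
apply/memv_imgP/andP => [[[a b] _ ->]|[x1A x2B]].
  by rewrite !lfunE /= /pair_fun /= !lfunE !subvsP.
exists (vsproj A x.1, vsproj B x.2); rewrite ?memvf //.
by rewrite !lfunE /= /pair_fun /= !lfunE /= !vsprojK //; case: x {x1A x2B}.
Qed.

Lemma dim_subvs (V : vectType F) (A : {vspace V}) :
  \dim {: subvs_of A} = \dim A.
Proof. by rewrite dimvf. Qed.

Lemma dimv_prodT : \dim {: (U1 * U2)%type} = (\dim {: U1} + \dim {: U2})%N.
Proof. by rewrite !dimvf. Qed.

End ProductSubspace.

Lemma dimv_prod (F : fieldType) (U1 U2 : vectType F)
    (A : {vspace U1}) (B : {vspace U2}) :
  \dim (prodv A B) = (\dim A + \dim B)%N.
Proof.
rewrite limg_dim_eq ?dimv_prodT ?dim_subvs // capfv.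
apply/eqP/lker0P => -[a b] [c d]; rewrite !lfunE /= /pair_fun /= !lfunE /=.
by case=> /val_inj -> /val_inj ->.
Qed.

Section PairMapSpaces.
Variables (F : fieldType) (U1 U2 V1 V2 : vectType F).
Variables (f : 'Hom(U1, V1)) (g : 'Hom(U2, V2)).

Lemma lker_pair : lker (pair_map f g) = prodv (lker f) (lker g).
Proof.
by apply/vspaceP => -[a b]; rewrite memv_prod !memv_ker lfunE.
Qed.

Lemma limg_pair : limg (pair_map f g) = prodv (limg f) (limg g).
Proof.
apply/vspaceP => -[a b]; rewrite memv_prod /=.
apply/memv_imgP/andP => [[[x y] _]|[/memv_imgP[x _ ->] /memv_imgP[y _ ->]]].
  by rewrite lfunE => -[-> ->]; rewrite !memv_img ?memvf.
by exists (x, y); rewrite ?memvf ?lfunE.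
Qed.

Lemma prodvI (A A' : {vspace U1}) (B B' : {vspace U2}) :
  (prodv A B :&: prodv A' B')%VS = prodv (A :&: A') (B :&: B').
Proof.
by apply/vspaceP => x; rewrite memv_cap !memv_prod !memv_cap andbACA.
Qed.

(** Only one inclusion is checked elementwise; the other one follows by counting
    dimensions, as the intersections are already known to match. *)
Lemma prodvD (A A' : {vspace U1}) (B B' : {vspace U2}) :
  (prodv A B + prodv A' B')%VS = prodv (A + A') (B + B').
Proof.
apply/eqP; rewrite eqEdim; apply/andP; split.
  rewrite subv_add; apply/andP.
  split; apply/subvP => x; rewrite !memv_prod => /andP[x1 x2].
    by rewrite (subvP (addvSl _ _) _ x1) (subvP (addvSl _ _) _ x2).
  by rewrite (subvP (addvSr _ _) _ x1) (subvP (addvSr _ _) _ x2).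
have := dimv_sum_cap (prodv A B) (prodv A' B').
rewrite prodvI !dimv_prod.
by have := dimv_sum_cap A A'; have := dimv_sum_cap B B'; lia.
Qed.

End PairMapSpaces.

(** * Diagrams on three vertices that have compatible bases *)

Definition o0 : 'I_3 := @Ordinal 3 0 isT.
Definition o2 : 'I_3 := @Ordinal 3 2 isT.

Lemma ord3P (P : 'I_3 -> Prop) : P o0 -> P mid -> P o2 -> forall v, P v.
Proof.
by move=> P0 P1 P2 [[|[|[|//]]] p]; rewrite (bool_irrelevance p isT).
Qed.

(** A family over the three vertices is specified by its values; their types
    differ, so that a case analysis on the vertex needs a transport. *)
Lemma fam3_exists (T : 'I_3 -> Type) (a : T o0) (b : T mid) (c : T o2) :
  {h : forall v, T v | [/\ h o0 = a, h mid = b & h o2 = c]}.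
Proof.
have h v : (v == o0) + (v == mid) + (v == o2).
  by case: v => [[|[|[|//]]] p]; [left; left | left; right | right].
exists (fun v => match h v with
  | inl (inl e) => ecast v (T v) (esym (eqP e)) a
  | inl (inr e) => ecast v (T v) (esym (eqP e)) b
  | inr e => ecast v (T v) (esym (eqP e)) c
  end).
by split; [case: (h o0) | case: (h mid) | case: (h o2)];
  do ?[case] => //= e; rewrite (eq_irrelevance (esym _) erefl).
Qed.

Definition fam3 (T : 'I_3 -> Type) (a : T o0) (b : T mid) (c : T o2) v : T v :=
  sval (fam3_exists a b c) v.

Lemma fam3E (T : 'I_3 -> Type) (a : T o0) (b : T mid) (c : T o2) :
  (fam3 a b c o0 = a) * (fam3 a b c mid = b) * (fam3 a b c o2 = c).
Proof. by rewrite /fam3; case: fam3_exists => h /= [-> -> ->]. Qed.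

Section Realize.
Variables (F : fieldType) (E : rel 'I_3) (Z : diag3 F E).
Implicit Type L : seq (itv3 * (forall v, Z v)).

(** The coordinate of a vector in a space that is the field or zero. *)
Definition ind_coef (b : bool) : ind_sp F b -> F :=
  if b return ind_sp F b -> F then fun x => x else fun _ => 0.

Lemma ind_coef_linear b : linear_for *%R (@ind_coef b).
Proof. by case: b => // c x y /=; rewrite mulr0 addr0. Qed.

(** A list of intervals, each with one vector per vertex, defines a map out of
    the sum of the interval modules: the k-th coordinate multiplies the k-th
    vector. *)
Fixpoint bar_fun L v : itv_sum F E (map fst L) v -> Z v :=
  if L is p :: L' return itv_sum F E (map fst L) v -> Z v then
    fun x => ind_coef x.1 *: p.2 v + bar_fun x.2
  else fun _ => 0.

Lemma bar_linear L v : linear (@bar_fun L v).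
Proof.
elim: L => [|p L IH] c x y /=; first by rewrite scaler0 addr0.
by rewrite IH ind_coef_linear scalerDl scalerDr scalerA addrACA.
Qed.
HB.instance Definition _ L v :=
  GRing.isLinear.Build F (itv_sum F E (map fst L) v) (Z v) _
    (@bar_fun L v) (@bar_linear L v).

Definition members L v := [seq p.2 v | p <- L & in_itv3 p.1 v].

Lemma bar_surj L v y : y \in <<members L v>>%VS -> exists x, @bar_fun L v x = y.
Proof.
rewrite /members; elim: L y => [|p L IH] y /=.
  by rewrite span_nil memv0 => /eqP ->; exists 0.
case: ifP => [pv|pv /IH[x <-]]; last first.
  by exists (0, x); rewrite /= scale0r add0r.
rewrite /= span_cons => /memv_addP[_ /vlineP[c ->] [y' /IH[x <-] ->]].
by exists (c, x).
Qed.

Lemma dim_itv_sum (s : seq itv3) v :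
  \dim {: itv_sum F E s v} = count (fun I => in_itv3 I v) s.
Proof.
elim: s => [|I s IH] /=; first by rewrite dimvf dim_matrix.
rewrite dimv_prodT IH; congr (_ + _)%N; rewrite dimvf /=.
by case: in_itv3; rewrite /= ?dim_matrix.
Qed.

(** A decomposition into intervals amounts to bases of the three spaces such
    that an arrow sends each basis vector to the basis vector of the same
    interval, or to 0 when the interval ends: then [bar_fun] is onto at each
    vertex, and the dimensions agree. *)
Lemma iso3_of_bases L :
    (forall v, basis_of {: Z v} (members L v)) ->
    (forall u v (e : E u v) p, List.In p L -> in_itv3 p.1 u ->
      dg_map Z e (p.2 u) = if in_itv3 p.1 v then p.2 v else 0) ->
  iso3 Z (itv_sum F E (map fst L)).
Proof.
move=> basisL mapL; pose h v := linfun (@bar_fun L v).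
have him v : limg (h v) = fullv.
  apply/vspaceP => y; rewrite memvf; apply/memv_imgP.
  have [|x <-] := @bar_surj L v y.
    by rewrite (span_basis (basisL v)) memvf.
  by exists x; rewrite ?memvf ?lfunE.
have hker v : lker (h v) == 0%VS.
  rewrite -dimv_eq0; have := limg_ker_dim (h v) fullv.
  rewrite him capfv dim_itv_sum (size_basis (X := in_tuple _) (basisL v)).
  rewrite size_map size_filter count_map => /eqP.
  by rewrite -[X in _ == X]add0n eqn_add2r.
have hcomm u v (e : E u v) x :
    dg_map Z e (h u x) = h v (dg_map (itv_sum F E (map fst L)) e x).
  rewrite !lfunE /= {basisL h him hker}.
  elim: L x mapL => [|p L IH] x mapL /=; first by rewrite linear0.
  rewrite linearD linearZ /= IH => [|u' v' e' q Lq]; last by apply: mapL; right.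
  rewrite lfunE /=; congr (_ + _).
  have := mapL u v e p (or_introl erefl).
  case: x => /= x _.
  move: x; case: (in_itv3 p.1 u); case: (in_itv3 p.1 v) => x //=.
  - by move=> ->; rewrite ?lfunE.
  - by move=> ->; rewrite // scaler0 scale0r.
  - by move=> _; rewrite lfunE /= !scale0r.
  - by move=> _; rewrite !scale0r.
have hVK v y : h v ((h v)^-1%VF y) = y by rewrite limg_lfunVK // him memvf.
exists (fun v => (h v)^-1%VF); split=> [v|u v e].
  by exists (h v) => y; [apply: hVK | apply: lker0_lfunK].
apply/lfunP => x; rewrite !comp_lfunE; have /lker0P := hker v; apply.
by rewrite -hcomm !hVK.
Qed.

End Realize.

(** * Invariants that count the simple module at the middle vertex *)

Section Invariants.
Variable F : fieldType.

Definition into0 : into_arrows o0 mid := erefl.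
Definition into2 : into_arrows o2 mid := erefl.
Definition out0 : out_arrows mid o0 := erefl.
Definition out2 : out_arrows mid o2 := erefl.

Definition into_image (Z : diag3 F into_arrows) : {vspace Z mid} :=
  (limg (dg_map Z into0) + limg (dg_map Z into2))%VS.

Definition out_kernel (Z : diag3 F out_arrows) : {vspace Z mid} :=
  (lker (dg_map Z out0) :&: lker (dg_map Z out2))%VS.

Lemma mid_itvE I :
  (I == mid_itv) = [&& in_itv3 I mid, ~~ in_itv3 I o0 & ~~ in_itv3 I o2].
Proof.
rewrite /in_itv3 -val_eqE /=; case: I => -[[l pl] [r pr]] /= lr.
rewrite xpair_eqE -!val_eqE /=; lia.
Qed.

Section Iso.
Variables (E : rel 'I_3) (Z Z' : diag3 F E) (h : forall v, 'Hom(Z v, Z' v)).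
Hypothesis hbij : forall v, bijective (h v).

Lemma bij_lker0 v : lker (h v) == 0%VS.
Proof. by apply/lker0P/bij_inj. Qed.

Lemma bij_limg v : limg (h v) = fullv.
Proof.
have [g _ hg] := hbij v; apply/vspaceP => y; rewrite memvf; apply/memv_imgP.
by exists (g y); rewrite ?memvf.
Qed.

Lemma dim_bij v (A : {vspace Z v}) : \dim (h v @: A) = \dim A.
Proof. by rewrite limg_dim_eq // (eqP (bij_lker0 v)) capv0. Qed.

Hypothesis hcomm : forall u v (e : E u v),
  (h v \o dg_map Z e = dg_map Z' e \o h u)%VF.

Lemma iso3_limg u v (e : E u v) :
  (h v @: limg (dg_map Z e))%VS = limg (dg_map Z' e).
Proof. by rewrite -limg_comp hcomm limg_comp bij_limg. Qed.

Lemma iso3_lker u v (e : E u v) :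
  (h u @: lker (dg_map Z e))%VS = lker (dg_map Z' e).
Proof.
have [g hK gK] := hbij u.
have kerE x : (h u x \in lker (dg_map Z' e)) = (x \in lker (dg_map Z e)).
  rewrite !memv_ker -comp_lfunE -hcomm comp_lfunE.
  by rewrite -[X in _ == X](linear0 (h v)) (inj_eq (bij_inj (hbij v))).
apply/vspaceP => y; rewrite -[y]gK kerE.
apply/memv_imgP/idP => [[x x_ker /(bij_inj (hbij u)) ->]|] //.
by exists (g y).
Qed.

End Iso.

(** Both sides are additive, and a one-interval summand contributes to the
    codimension exactly when the interval contains the middle vertex but neither
    source. *)
Lemma into_image_itv_sum s :
  (count_mem mid_itv s + \dim (into_image (itv_sum F into_arrows s)) =
   \dim {: itv_sum F into_arrows s mid})%N.
Proof.
elim: s => [|I s IH] /=.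
  by apply/eqP; rewrite add0n eqn_leq dimvS ?subvf //= dimvf dim_matrix.
rewrite /into_image /= !limg_pair prodvD dimv_prod dimv_prodT -IH addnACA.
congr (_ + _)%N; rewrite mid_itvE dimvf.
by case: (in_itv3 I mid); case: (in_itv3 I o0); case: (in_itv3 I o2) => /=;
  rewrite ?lim0g ?lim1g ?add0v ?addv0 ?addvv ?dimv0 ?dimvf ?dim_matrix.
Qed.

Lemma out_kernel_itv_sum s :
  count_mem mid_itv s = \dim (out_kernel (itv_sum F out_arrows s)).
Proof.
have ker0 (U V : vectType F) : lker (0 : 'Hom(U, V)) = fullv.
  by apply/vspaceP => x; rewrite memv_ker lfunE memvf /= eqxx.
have ker1 (U : vectType F) : lker (\1%VF : 'Hom(U, U)) = 0%VS.
  by apply/eqP/lker0P => x y; rewrite !lfunE.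
elim: s => [|I s IH] /=.
  apply/eqP; rewrite eq_sym -leqn0 (leq_trans (dimvS (subvf _))) //.
  by rewrite dimvf dim_matrix.
rewrite /out_kernel /= !lker_pair prodvI dimv_prod -IH.
congr (_ + _)%N; rewrite mid_itvE.
by case: (in_itv3 I mid); case: (in_itv3 I o0); case: (in_itv3 I o2) => /=;
  rewrite ?ker0 ?ker1 ?cap0v ?capv0 ?capvv ?dimv0 ?dimvf ?dim_matrix.
Qed.

End Invariants.

(** * Existence of the decompositions *)

Section FourPieces.
Variables (F : fieldType) (V : vectType F) (U W : {vspace V}).

Lemma four_pieces_dim :
  (\dim (U :&: W) + \dim (U :\: W) + \dim (W :\: U) + \dim (U + W)^C)%N
  = \dim {: V}.
Proof.
have := dimv_cap_compl U W; have := dimv_cap_compl W U; rewrite capvC.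
have := dimv_sum_cap U W; have := dimv_compl (U + W).
have := dimvS (subvf (U + W)); lia.
Qed.

(** A basis adapted to two subspaces at once: each of U, W, their intersection
    and their sum is spanned by some of the four pieces. It serves with the two
    images of an inward frame and with the two kernels of an outward frame. *)
Lemma four_pieces_basis :
  basis_of {: V} (vbasis (U :&: W) ++ vbasis (U :\: W) ++ vbasis (W :\: U)
                  ++ vbasis (U + W)^C).
Proof.
rewrite basisEdim !size_cat !size_tuple !addnA four_pieces_dim leqnn andbT.
rewrite !span_cat !(span_basis (vbasisP _)) !addvA [(U :&: W + _)%VS]addvC.
rewrite addv_diff_cap [(U + _)%VS]addvC addv_diff [(W + U)%VS]addvC.
by rewrite addv_complf.
Qed.

End FourPieces.

Section MapBases.
Variables (F : fieldType) (V W : vectType F) (k : 'Hom(V, W)).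

(** The basis at an outer vertex of an inward frame, with U the image of the
    arrow from the other outer vertex. The kernel of the arrow k gives the
    intervals that stop at that vertex; the other vectors are preimages of the
    part of the middle basis that lies in the image of k. *)
Lemma lifted_basis (U : {vspace W}) :
  basis_of {: V} (vbasis (lker k) ++ map (k^-1)%VF (vbasis (limg k :&: U))
                  ++ map (k^-1)%VF (vbasis (limg k :\: U))).
Proof.
rewrite basisEdim !size_cat !size_map !size_tuple dimv_cap_compl.
apply/andP; split; last by rewrite -(limg_ker_dim k {: V}) capfv.
rewrite !span_cat -!limg_span !(span_basis (vbasisP _)) -limgD addvC.
rewrite [(limg k :&: U + _)%VS]addvC addv_diff_cap addvC.
(* Each x is a lift of k x plus an element of the kernel. *)
apply/subvP => x _; rewrite -[x](subrK (k^-1 (k x))%VF).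
rewrite memv_add ?memv_img ?memvf // memv_ker linearB /= limg_lfunVK ?subrr //.
by rewrite memv_img ?memvf.
Qed.

(** The basis at an outer vertex of an outward frame, with U the kernel of the
    arrow to the other outer vertex. The pieces of the middle basis outside the
    kernel of k are mapped injectively, and a complement of the image gives the
    intervals that start at that vertex. *)
Lemma image_basis (U : {vspace V}) :
  basis_of {: W} (map k (vbasis (U :\: lker k))
    ++ map k (vbasis (lker k + U)^C) ++ vbasis (limg k)^C).
Proof.
rewrite basisEdim !size_cat !size_map !size_tuple; apply/andP; split.
  rewrite !span_cat -!limg_span !(span_basis (vbasisP _)) addvA -limgD.
  suff -> : (k @: (U :\: lker k + (lker k + U)^C))%VS = limg k.
    by rewrite addv_complf.
  have k0 : (k @: lker k = 0)%VS by apply/eqP; rewrite -lkerE.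
  rewrite -[LHS]addv0 -k0 -limgD -addvA [(_^C + _)%VS]addvC addvA.
  by rewrite addv_diff [(U + _)%VS]addvC addv_complf.
have := limg_ker_dim k {: V}; rewrite capfv.
have := four_pieces_dim (lker k) U; have := dimv_cap_compl (lker k) U.
by have := dimv_compl (limg k); have := dimvS (subvf (limg k)); lia.
Qed.

End MapBases.

Section BlockList.
Variables (F : fieldType) (E : rel 'I_3) (Z : diag3 F E).

(** One interval repeated along a list X of parameters, with the vectors at the
    three vertices given as functions of the parameter. *)
Definition block (T : Type) (I : itv3) (a : T -> Z o0) (b : T -> Z mid)
    (c : T -> Z o2) (X : seq T) : seq (itv3 * (forall v, Z v)) :=
  [seq (I, fam3 (a x) (b x) (c x)) | x <- X].

Lemma members_cat (L1 L2 : seq (itv3 * (forall v, Z v))) v :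
  members (L1 ++ L2) v = members L1 v ++ members L2 v.
Proof. by rewrite /members filter_cat map_cat. Qed.

Lemma members_block (T : Type) I a b c (X : seq T) :
  ((members (block I a b c X) o0 = if in_itv3 I o0 then map a X else [::]) *
   (members (block I a b c X) mid = if in_itv3 I mid then map b X else [::]) *
   (members (block I a b c X) o2 = if in_itv3 I o2 then map c X else [::])
  )%type.
Proof.
rewrite /members /block; do 2?split; elim: X => [|x X] /=;
  by case: ifP => //= _ ->; rewrite fam3E.
Qed.

Lemma In_block (T : eqType) I a b c (X : seq T) p :
  List.In p (block I a b c X) ->
  exists2 x, x \in X & p = (I, fam3 (a x) (b x) (c x)).
Proof.
elim: X => //= x X IH [<-|/IH[y yX ->]]; first by exists x; rewrite ?mem_head.
by exists y; rewrite // in_cons yX orbT.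
Qed.

End BlockList.

Local Notation "<< l , r >>itv" :=
  (@exist _ (fun bd : 'I_3 * 'I_3 => (bd.1 <= bd.2)%N) (l, r) isT).

Section Existence.
Variable F : fieldType.

Lemma into_decomposition (Z : diag3 F into_arrows) :
  exists s, iso3 Z (itv_sum F into_arrows s).
Proof.
pose f := dg_map Z into0; pose g := dg_map Z into2.
pose f' := (f^-1)%VF; pose g' := (g^-1)%VF.
pose L :=
     block << o0, o0 >>itv id \0 \0 (vbasis (lker f))
  ++ block << o2, o2 >>itv \0 \0 id (vbasis (lker g))
  ++ block << o0, o2 >>itv f' id g' (vbasis (limg f :&: limg g))
  ++ block << o0, mid >>itv f' id \0 (vbasis (limg f :\: limg g))
  ++ block << mid, o2 >>itv \0 id g' (vbasis (limg g :\: limg f))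
  ++ block << mid, mid >>itv \0 id \0 (vbasis (limg f + limg g)^C).
have fV x : x \in limg f -> f (f' x) = x by apply: limg_lfunVK.
have gV x : x \in limg g -> g (g' x) = x by apply: limg_lfunVK.
exists (map fst L); apply: iso3_of_bases.
  elim/ord3P; rewrite !members_cat /L !members_block /= ?cats0 ?map_id.
  - exact: lifted_basis.
  - exact: four_pieces_basis.
  - by rewrite capvC; apply: lifted_basis.
move=> u v; elim/ord3P: u; elim/ord3P: v => // e p;
  rewrite ?(eq_irrelevance e into0) ?(eq_irrelevance e into2)
    /L !List.in_app_iff;
  do ![case]; move=> /In_block[x /vbasis_mem xU ->] //= _;
  rewrite !fam3E ?linear0 //; move: xU.
- by rewrite memv_ker => /eqP.
- by rewrite memv_cap => /andP[/fV].
- by move/(subvP (diffvSl _ _))/fV.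
- by rewrite memv_ker => /eqP.
- by rewrite memv_cap => /andP[_ /gV].
- by move/(subvP (diffvSl _ _))/gV.
Qed.

Lemma out_decomposition (Z : diag3 F out_arrows) :
  exists s, iso3 Z (itv_sum F out_arrows s).
Proof.
pose f := dg_map Z out0; pose g := dg_map Z out2.
pose L :=
     block << mid, mid >>itv \0 id \0 (vbasis (lker f :&: lker g))
  ++ block << mid, o2 >>itv \0 id g (vbasis (lker f :\: lker g))
  ++ block << o0, mid >>itv f id \0 (vbasis (lker g :\: lker f))
  ++ block << o0, o2 >>itv f id g (vbasis (lker f + lker g)^C)
  ++ block << o0, o0 >>itv id \0 \0 (vbasis (limg f)^C)
  ++ block << o2, o2 >>itv \0 \0 id (vbasis (limg g)^C).
exists (map fst L); apply: iso3_of_bases.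
  elim/ord3P; rewrite !members_cat /L !members_block /= ?cats0 ?map_id.
  - exact: image_basis.
  - exact: four_pieces_basis.
  - by rewrite addvC; apply: image_basis.
have kerD (W : vectType F) (k : 'Hom(Z mid, W)) (U : {vspace Z mid}) x :
    x \in (lker k :\: U)%VS -> k x = 0.
  by move/(subvP (diffvSl _ _)); rewrite memv_ker => /eqP.
move=> u v; elim/ord3P: u; elim/ord3P: v => // e p;
  rewrite ?(eq_irrelevance e out0) ?(eq_irrelevance e out2)
    /L !List.in_app_iff;
  do ![case]; move=> /In_block[x /vbasis_mem xU ->] //= _;
  rewrite !fam3E ?linear0 //; move: xU.
- by rewrite memv_cap !memv_ker => /andP[/eqP].
- exact: kerD.
- by rewrite memv_cap !memv_ker => /andP[_ /eqP].
- exact: kerD.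
Qed.

(** The barcode falls back to the empty list for a diagram without any
    decomposition, so existence has to be supplied. *)
Lemma barcodeP (E : rel 'I_3) (Z : diag3 F E) :
  (exists s, iso3 Z (itv_sum F E s)) -> iso3 Z (itv_sum F E (barcode Z)).
Proof.
case=> s sP; rewrite /barcode.
by case: classical_sets.xgetP => [t -> //|/(_ s)].
Qed.

Lemma into_multiplicity (Z : diag3 F into_arrows) :
  (multiplicity mid_itv Z + \dim (into_image Z))%N = \dim {: Z mid}.
Proof.
have [h [hbij hcomm]] := barcodeP (into_decomposition Z).
rewrite -[RHS](dim_bij hbij) bij_limg // -into_image_itv_sum; congr (_ + _)%N.
rewrite -(dim_bij hbij) limgD.
by congr (\dim (_ + _)); apply: iso3_limg.
Qed.

Lemma out_multiplicity (Z : diag3 F out_arrows) :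
  multiplicity mid_itv Z = \dim (out_kernel Z).
Proof.
have [h [hbij hcomm]] := barcodeP (out_decomposition Z).
rewrite /multiplicity (out_kernel_itv_sum F) -(dim_bij hbij).
rewrite lker0_img_cap ?bij_lker0 //.
by congr (\dim (_ :&: _)); symmetry; apply: iso3_lker.
Qed.

End Existence.

(** * The frames of a module extended by zero *)

Section Vertices.
Variable F : fieldType.
Implicit Type M : pmod F.

Lemma vtxS1 i j : vtx i.+1 j - e1 = vtx i j.
Proof. by congr pair => /=; lia. Qed.

Lemma vtxS2 i j : vtx i j.+1 - e2 = vtx i j.
Proof. by congr pair => /=; lia. Qed.

Lemma vtxD1 i j : vtx i j + e1 = vtx i.+1 j.
Proof. by congr pair => /=; lia. Qed.

Lemma vtxD2 i j : vtx i j + e2 = vtx i j.+1.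
Proof. by congr pair => /=; lia. Qed.

Lemma vtxS12 i j : vtx i.+1 j.+1 - e1 - e2 = vtx i j.
Proof. by rewrite vtxS1 vtxS2. Qed.

Lemma dimv_outside M (p : int * int) : (p.1 < 0) || (p.2 < 0) -> dimv M p = 0%N.
Proof.
by case: p => -[i|i] [j|j] //= _; rewrite /dimv dimvf /= dim_matrix.
Qed.

Lemma ext_phi_x M i j : ext_phi M (vtx i j) (vtx i.+1 j) = pm_x M i j.
Proof. by rewrite /= phiSx // /phi !steps_refl !comp_lfun1r. Qed.

Lemma ext_phi_y M i j : ext_phi M (vtx i j) (vtx i j.+1) = pm_y M i j.
Proof. by rewrite /= phiSy // /phi !steps_refl !comp_lfun1r. Qed.

Definition img_x M i j : {vspace M i j} :=
  limg (ext_phi M (vtx i j - e1) (vtx i j)).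

Definition img_y M i j : {vspace M i j} :=
  limg (ext_phi M (vtx i j - e2) (vtx i j)).

Lemma limg_outside M p q : (p.1 < 0) || (p.2 < 0) ->
  limg (ext_phi M p q) = 0%VS.
Proof.
move=> /(dimv_outside M) p0; apply/eqP; rewrite -dimv_eq0 -leqn0 -p0.
by have := limg_ker_dim (ext_phi M p q) fullv; rewrite /dimv; lia.
Qed.

Lemma img_x0 M j : img_x M 0 j = 0%VS.
Proof. by rewrite /img_x limg_outside. Qed.

Lemma img_y0 M i : img_y M i 0 = 0%VS.
Proof. by rewrite /img_y limg_outside // orbC. Qed.

Lemma img_xS M i j : img_x M i.+1 j = limg (pm_x M i j).
Proof. by rewrite /img_x vtxS1 ext_phi_x. Qed.

Lemma img_yS M i j : img_y M i j.+1 = limg (pm_y M i j).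
Proof. by rewrite /img_y vtxS2 ext_phi_y. Qed.

Lemma beta0_dim M i j :
  (beta0 M i j + \dim (img_into M i j))%N = \dim {: M i j}.
Proof.
by rewrite /beta0 dim_subvs dimv_compl subnK // dimvS // subvf.
Qed.

Lemma beta0_y_mult M i j : beta0 M i j = y_mult M (vtx i j).
Proof.
apply/eqP; rewrite -(eqn_add2r (\dim (img_into M i j))) beta0_dim eq_sym.
exact/eqP/(into_multiplicity (into_frame M (vtx i j))).
Qed.

Definition both_ker M i j : {vspace M i j} :=
  (lker (pm_x M i j) :&: lker (pm_y M i j))%VS.

Lemma lker_out1 M i j :
  lker (ext_phi M (vtx i j) (vtx i j + e1)) = lker (pm_x M i j).
Proof. by rewrite vtxD1 ext_phi_x. Qed.

Lemma lker_out2 M i j :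
  lker (ext_phi M (vtx i j) (vtx i j + e2)) = lker (pm_y M i j).
Proof. by rewrite vtxD2 ext_phi_y. Qed.

Lemma z_mult_vtx M i j : z_mult M (vtx i j) = \dim (both_ker M i j).
Proof.
rewrite /z_mult out_multiplicity; congr (\dim (_ :&: _)).
  exact: etrans (lker_out1 M i j) _.
exact: etrans (lker_out2 M i j) _.
Qed.

Lemma z_mult_outside M p : (p.1 < 0) || (p.2 < 0) -> z_mult M p = 0%N.
Proof.
move=> /(dimv_outside M) p0; apply/eqP; rewrite -leqn0 -p0 /z_mult.
rewrite out_multiplicity.
exact: dimvS (subvf _).
Qed.

End Vertices.

(** * Free modules *)

Section Push.
Variable F : fieldType.

Lemma pushE (I J : finType) (u : I -> J) (x : {ffun I -> F^o}) a :
  injective u -> push u x (u a) = x a.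
Proof.
by move=> ui; rewrite ffunE (big_pred1 a) // => b; rewrite (inj_eq ui).
Qed.

Lemma push_out (I J : finType) (u : I -> J) (x : {ffun I -> F^o}) b :
  b \notin codom u -> push u x b = 0.
Proof.
move=> ub; rewrite ffunE big_pred0 // => a; apply: contraNF ub => /eqP <-.
exact: codom_f.
Qed.

Lemma push_inj (I J : finType) (u : I -> J) :
  injective u -> injective (push (F := F) u).
Proof.
by move=> ui x y /ffunP xy; apply/ffunP => a; have := xy (u a); rewrite !pushE.
Qed.

(** Functions supported on the images of two injections u and v, and equal after
    pushing forward, are supported on the common part of these images, here
    parametrized by u \o v' = v \o u'. *)
Lemma push_pullback (I J K L : finType) (u : I -> K) (v : J -> K)
    (v' : L -> I) (u' : L -> J) (p : {ffun I -> F^o}) (q : {ffun J -> F^o}) :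
    injective u -> injective v -> injective v' ->
    (forall l, u (v' l) = v (u' l)) ->
    (forall a b, u a = v b -> a \in codom v') ->
    push u p = push v q ->
  exists t, p = push v' t /\ q = push u' t.
Proof.
move=> ui vi v'i comm pull pq; pose t : {ffun L -> F^o} := [ffun l => p (v' l)].
have pE : p = push v' t.
  apply/ffunP => a; have [/codomP[l ->]|a_out] := boolP (a \in codom v').
    by rewrite pushE ?ffunE.
  rewrite (push_out _ a_out) -(pushE p a ui) pq push_out //.
  by apply: contra a_out => /codomP[b /pull].
exists t; split=> //; apply: (push_inj vi); rewrite -pq pE !push_comp.
by apply/ffunP => c; rewrite !ffunE; apply: eq_bigl => l /=; rewrite comm.
Qed.

End Push.

Section FreeModules.
Variables (F : fieldType) (d : nat -> nat -> nat).

(** A generator as a triple of numbers, independent of the vertex (i, j); this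
    avoids comparing elements of dependent pairs. *)
Definition code i j (g : gens d i j) : nat * nat * nat :=
  (val (tag g).1, val (tag g).2, val (tagged g)).

Lemma code_inj i j : injective (@code i j).
Proof.
move=> [[a b] k] [[a' b'] k'] [/val_inj aE /val_inj bE]; rewrite /= in aE bE *.
by subst a' b' => /val_inj ->.
Qed.

Lemma incl_x_inj i j : injective (@incl_x d i j).
Proof. by move=> g h /(congr1 (@code _ _)) gh; apply: code_inj. Qed.

Lemma incl_y_inj i j : injective (@incl_y d i j).
Proof. by move=> g h /(congr1 (@code _ _)) gh; apply: code_inj. Qed.

Lemma incl_pullback i j (g : gens d i j.+1) (h : gens d i.+1 j) :
  incl_x g = incl_y h -> g \in codom (@incl_y d i j).
Proof.
move: g h => [[a b] k] [[a' b'] k'] /(congr1 (@code _ _))[_ bE _].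
apply/codomP; exists (@existT _ (fun c : 'I_i.+1 * 'I_j.+1 => 'I_(d c.1 c.2))
  (a, b') (cast_ord (congr1 (d a) bE) k)).
exact/code_inj/(congr1 (fun m => (val a, m, val k)) bE).
Qed.

Lemma free_x_inj i j : lker (pm_x (free F d) i j) == 0%VS.
Proof.
by apply/lker0P => x y; rewrite !lfunE; apply: push_inj; apply: incl_x_inj.
Qed.

Lemma free_y_inj i j : lker (pm_y (free F d) i j) == 0%VS.
Proof.
by apply/lker0P => x y; rewrite !lfunE; apply: push_inj; apply: incl_y_inj.
Qed.

(** In a free module the multiples of x_1 that are also multiples of x_2 are the
    multiples of x_1 x_2. *)
Lemma free_pullback i j (p : free F d i j.+1) (q : free F d i.+1 j) :
  pm_x (free F d) i j.+1 p = pm_y (free F d) i.+1 j q ->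
  exists t : free F d i j,
    p = pm_y (free F d) i j t /\ q = pm_x (free F d) i j t.
Proof.
rewrite !lfunE => /push_pullback.
move=> /(_ _ _ _ (@incl_x_inj _ _) (@incl_y_inj _ _) (@incl_y_inj i j)).
move=> /(_ _ (@incl_comm d i j) (@incl_pullback i j))[t [-> ->]].
by exists t; rewrite !lfunE.
Qed.

Lemma dim_free i j :
  \dim {: free F d i j} = (\sum_(a < i.+1) \sum_(b < j.+1) d a b)%N.
Proof.
rewrite dimvf /= [LHS](_ : _ = #|gens d i j|); last first.
  by rewrite -[RHS]muln1.
rewrite card_tagged sumnE big_map big_enum /= pair_bigA /=.
by apply: eq_bigr => ab _; rewrite card_ord.
Qed.

(** The dimension at (i, j) is the number of generators in the rectangle below
    (i, j), and inclusion-exclusion isolates the corner. *)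
Lemma free_euler i j (a := vtx i j) :
  (dimv (free F d) a + dimv (free F d) (a - e1 - e2)%R =
   d i j + dimv (free F d) (a - e1)%R + dimv (free F d) (a - e2)%R)%N.
Proof.
have dimE k l : dimv (free F d) (vtx k l) =
    (\sum_(m < k.+1) \sum_(n < l.+1) d m n)%N by exact: dim_free.
rewrite {}/a; case: i j => [|i] [|j].
- rewrite (@dimv_outside _ _ (_ - e1 - e2)) // (@dimv_outside _ _ (_ - e1)) //.
  by rewrite (@dimv_outside _ _ (_ - e2)) ?orbT // dimE !big_ord1 !addn0.
- rewrite (@dimv_outside _ _ (_ - e1 - e2)) // (@dimv_outside _ _ (_ - e1)) //.
  by rewrite vtxS2 !dimE !big_ord1 big_ord_recr /= !addn0 addnC.
- rewrite (@dimv_outside _ _ (_ - e1 - e2)) ?orbT //.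
  rewrite (@dimv_outside _ _ (_ - e2)) ?orbT //.
  by rewrite vtxS1 !dimE big_ord_recr /= !big_ord1 !addn0 addnC.
have rowE : (\sum_(n < j.+2) d i.+1 n =
    \sum_(n < j.+1) d i.+1 n + d i.+1 j.+1)%N.
  by rewrite big_ord_recr.
have rectE l : (\sum_(m < i.+2) \sum_(n < l.+1) d m n =
    \sum_(m < i.+1) \sum_(n < l.+1) d m n + \sum_(n < l.+1) d i.+1 n)%N.
  by rewrite big_ord_recr.
rewrite vtxS12 vtxS1 vtxS2 !dimE !rectE rowE.
by rewrite -!addnA [RHS]addnCA; congr (_ + _)%N; rewrite addnC addnA.
Qed.

End FreeModules.

(** * The free cover and the first syzygy *)

Section Cover.
Variables (F : fieldType) (N : pmod F) (w : min_gens N).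
Local Notation Fr := (F0 N).
Local Notation K := (K0 w).
Local Notation g := (gamma_map w).

Lemma pm_xK i j : (lker (pm_x K i j) == 0%VS).
Proof.
apply/lker0P => u v uv; apply: val_inj; apply: (lker0P (free_x_inj F _ i j)).
by rewrite -!(ker_xE (f := gamma w)); congr vsval.
Qed.

Lemma pm_yK i j : (lker (pm_y K i j) == 0%VS).
Proof.
apply/lker0P => u v uv; apply: val_inj; apply: (lker0P (free_y_inj F _ i j)).
by rewrite -!(ker_yE (f := gamma w)); congr vsval.
Qed.

(** Multiplication by x_1 alone is already injective on a submodule of a free
    module. *)
Lemma z_mult_syzygy p : z_mult K p = 0%N.
Proof.
case: p => -[i|i] [j|j]; try by rewrite z_mult_outside.
rewrite (_ : z_mult K _ = z_mult K (vtx i j)) // z_mult_vtx /both_ker.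
by rewrite (eqP (pm_xK i j)) cap0v dimv0.
Qed.

Lemma gamma_gen i j (k : 'I_(beta0 N i j)) : tnth (w i j) k \in limg (g i j).
Proof.
pose e : gens (beta0 N) i j := @existT _
  (fun a : 'I_i.+1 * 'I_j.+1 => 'I_(beta0 N a.1 a.2)) (ord_max, ord_max) k.
have -> : tnth (w i j) k = g i j [ffun h => (h == e)%:R].
  rewrite lfunE /= /gamma_fun (bigD1 e) //= big1 => [|h /negPf he].
    rewrite ffunE eqxx scale1r addr0 /gen_img /= /phi.
    by rewrite !steps_refl !lfunE /= !lfunE.
  by rewrite ffunE he scale0r.
by rewrite memv_img ?memvf.
Qed.

Lemma span_min_gens i j : (<<w i j>> + img_into N i j)%VS = fullv.
Proof.
apply/vspaceP => v; rewrite memvf; pose q := quot_pi (img_into N i j).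
have : q v \in (q @: <<w i j>>)%VS.
  by rewrite limg_span (span_basis (mg_basis w i j)) memvf.
move=> /memv_imgP[u uw qvu]; rewrite -[v](subrK u) addrC memv_add //.
by rewrite -(lker_quot_pi (img_into N i j)) memv_ker linearB /= subr_eq0 qvu.
Qed.

Lemma img_intoE (M : pmod F) i j :
  img_into M i j = (img_x M i j + img_y M i j)%VS.
Proof. by []. Qed.

(** Graded Nakayama, by induction on the two coordinates: the chosen generators
    span a complement of the images of the two incoming maps, which are
    covered by the previous vertices. *)
Lemma gamma_surj i j : limg (g i j) = fullv.
Proof.
have gx i' j' : limg (g i' j') = fullv ->
    (img_x N i'.+1 j' <= limg (g i'.+1 j'))%VS.
  by move=> gs; rewrite img_xS -gs -limg_comp gamma_x limg_comp limgS ?subvf.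
have gy i' j' : limg (g i' j') = fullv ->
    (img_y N i' j'.+1 <= limg (g i' j'.+1))%VS.
  by move=> gs; rewrite img_yS -gs -limg_comp gamma_y limg_comp limgS ?subvf.
have step i' j' : (img_x N i' j' <= limg (g i' j'))%VS ->
    (img_y N i' j' <= limg (g i' j'))%VS -> limg (g i' j') = fullv.
  move=> sx sy; apply/eqP; rewrite eqEsubv subvf /= -span_min_gens img_intoE.
  rewrite !subv_add sx sy !andbT; apply/span_subvP => _ /tnthP[k ->].
  exact: gamma_gen.
elim: i j => [|i IHi]; elim=> [|j IHj]; apply: step;
  by rewrite ?img_x0 ?img_y0 ?sub0v ?gx ?gy.
Qed.

Lemma syzygy_dim p : dimv Fr p = (dimv K p + dimv N p)%N.
Proof.
case: p => -[i|i] [j|j]; try by rewrite !dimv_outside.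
rewrite /dimv [LHS](_ : _ = \dim {: Fr i j}) //.
by rewrite -(limg_ker_dim (g i j) fullv) gamma_surj capfv /= dim_subvs.
Qed.

(** Both sides count the t in F_0 at (i, j) whose image in N is killed by x_1
    and x_2: t |-> x_1 x_2 t maps them injectively onto the intersection, and
    they form the preimage under the cover of the common kernel. *)
Lemma syzygy_meet i j :
  \dim (img_x K i.+1 j.+1 :&: img_y K i.+1 j.+1) =
  (\dim {: K i j} + \dim (both_ker N i j))%N.
Proof.
rewrite img_xS img_yS.
pose T := (g i j @^-1: both_ker N i j)%VS.
pose xy := (pm_x Fr i j.+1 \o pm_y Fr i j)%VF.
pose iota := linfun (vsval : K i.+1 j.+1 -> Fr i.+1 j.+1).
have xy_inj : lker xy == 0%VS.
  apply/lker0P => s t; rewrite !comp_lfunE.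
  move=> /(lker0P (free_x_inj F _ i j.+1)).
  by move=> /(lker0P (free_y_inj F _ i j)).
have iota_inj : lker iota == 0%VS.
  by apply/lker0P => s t; rewrite !lfunE => /val_inj.
have dimT : \dim T = (\dim {: K i j} + \dim (both_ker N i j))%N.
  rewrite -(limg_ker_dim (g i j) T) lpreimK ?gamma_surj ?subvf //.
  congr (_ + _)%N; rewrite dim_subvs; congr (\dim _); apply/capv_idPr.
  by rewrite -lpreim0 lpreimS ?sub0v.
rewrite -{}dimT -[RHS](limg_dim_eq (f := xy)) ?(eqP xy_inj) ?capv0 //.
rewrite -[LHS](limg_dim_eq (f := iota)) ?(eqP iota_inj) ?capv0 //.
congr (\dim _); apply/vspaceP => z.
have gxE k l t : g k.+1 l (pm_x Fr k l t) = pm_x N k l (g k l t).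
  by rewrite -!comp_lfunE gamma_x.
have gyE k l t : g k l.+1 (pm_y Fr k l t) = pm_y N k l (g k l t).
  by rewrite -!comp_lfunE gamma_y.
apply/memv_imgP/memv_imgP => [[k]|[t]].
  rewrite memv_cap => /andP[/memv_imgP[u _ ku] /memv_imgP[v _ kv]] ->.
  have ku' : vsval k = pm_x Fr i j.+1 (vsval u).
    by rewrite ku; apply: (ker_xE (f := gamma w)).
  have kv' : vsval k = pm_y Fr i.+1 j (vsval v).
    by rewrite kv; apply: (ker_yE (f := gamma w)).
  have [t [ut vt]] := free_pullback (etrans (esym ku') kv').
  exists t; last by rewrite lfunE comp_lfunE /= ku' ut.
  rewrite -memv_preim memv_cap !memv_ker -gxE -gyE -ut -vt -!memv_ker.
  by rewrite !subvsP.
rewrite -memv_preim memv_cap !memv_ker -gxE -gyE -!memv_ker => /andP[xt yt] ->.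
pose u : K i j.+1 := vsproj (lker (g i j.+1)) (pm_y Fr i j t).
pose v : K i.+1 j := vsproj (lker (g i.+1 j)) (pm_x Fr i j t).
have xuE : vsval (pm_x K i j.+1 u) = xy t.
  by rewrite (ker_xE (f := gamma w)) vsprojK // comp_lfunE.
have yvE : vsval (pm_y K i.+1 j v) = xy t.
  by rewrite (ker_yE (f := gamma w)) vsprojK // -comp_lfunE -pm_comm.
exists (pm_x K i j.+1 u); last by rewrite -xuE lfunE.
rewrite memv_cap memv_img ?memvf //=.
have -> : pm_x K i j.+1 u = pm_y K i.+1 j v.
  by apply: val_inj; apply: etrans xuE (esym yvE).
by rewrite memv_img ?memvf.
Qed.

Lemma dim_img_x i j : \dim (img_x K i j) = dimv K (vtx i j - e1).
Proof.
case: i => [|i]; first by rewrite img_x0 dimv0 dimv_outside.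
by rewrite img_xS vtxS1 limg_dim_eq // (eqP (pm_xK i j)) capv0.
Qed.

Lemma dim_img_y i j : \dim (img_y K i j) = dimv K (vtx i j - e2).
Proof.
case: j => [|j]; first by rewrite img_y0 dimv0 dimv_outside ?orbT.
by rewrite img_yS vtxS2 limg_dim_eq // (eqP (pm_yK i j)) capv0.
Qed.

(** The spaces x_1 K and x_2 K have the dimensions of K at the preceding
    vertices, so the dimension of their sum is known once that of their meet is,
    which is [syzygy_meet], or 0 on the boundary of the quadrant. *)
Lemma beta0_syzygy i j (a := vtx i j) :
  (beta0 K i j + dimv K (a - e1)%R + dimv K (a - e2)%R =
   dimv K a + dimv K (a - e1 - e2)%R + z_mult N (a - e1 - e2)%R)%N.
Proof.
have meetE : \dim (img_x K i j :&: img_y K i j) =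
    (dimv K (a - e1 - e2)%R + z_mult N (a - e1 - e2)%R)%N.
  rewrite {}/a; case: i j => [|i] [|j].
  - by rewrite img_x0 cap0v dimv0 dimv_outside ?z_mult_outside.
  - by rewrite img_x0 cap0v dimv0 dimv_outside ?z_mult_outside.
  - by rewrite img_y0 capv0 dimv0 dimv_outside ?z_mult_outside ?orbT.
  - by rewrite syzygy_meet vtxS12 z_mult_vtx.
have := beta0_dim K i j; rewrite img_intoE.
have := dimv_sum_cap (img_x K i j) (img_y K i j).
rewrite meetE dim_img_x dim_img_y -/a => sumE baseE.
by rewrite -addnA -sumE [dimv K a](_ : _ = \dim {: K i j}) // -baseE !addnA.
Qed.

End Cover.

Theorem theorem2p1 (F : fieldType) (w : forall N : pmod F, min_gens N)
    (M : pmod F) (hM : finitely_presented M) (i j : nat) :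
  let a : int * int := vtx i j in
  [/\ betti w 0 M i j = y_mult M a,
      (betti w 1 M i j)%:Z =
        (y_mult M a)%:Z - (dimv M a)%:Z + (dimv M (a - e1))%:Z
        + (dimv M (a - e2))%:Z - (dimv M (a - e1 - e2))%:Z
        + (z_mult M (a - e1 - e2))%:Z
    & betti w 2 M i j = z_mult M (a - e1 - e2)].
Proof.
move=> a.
have b0 : beta0 M i j = y_mult M a := beta0_y_mult M i j.
have b1 := beta0_syzygy (w M) i j.
have b2 := beta0_syzygy (w (K0 (w M))) i j.
have eM := free_euler F (beta0 M) i j.
have eK := free_euler F (beta0 (K0 (w M))) i j.
cbv zeta in b1, b2, eM, eK.
rewrite z_mult_syzygy addn0 in b2.
(* The dimensions of the two free covers are eliminated, which leaves a linear
   system in the dimensions of M and of its first two syzygies. *)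
rewrite !(syzygy_dim (w M)) in eM.
rewrite !(syzygy_dim (w (K0 (w M)))) in eK.
rewrite -/a in b1 b2 eM eK.
have bettiE k :
  betti w k M i j = beta0 (iter k (fun N => K0 (w N)) M) i j by [].
rewrite !{}bettiE /= -b0.
split; lia.
Qed.
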